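(* Let $k$ be a field, $n\ge2$, $p(x)=x^2-\alpha x+\beta\in k[x]$ and $q(x)=x^2+\alpha x+\beta$. The map $(\varphi,a)\mapsto\tau_{\varphi,a}$ (see context) gives a one-to-one correspondence between the set of colored quivers $Q_f$ (i.e. pairs $(\varphi,a)$, $\varphi$ a self-map of $\{e_1,\dots,e_n\}$ and $a\in k^n$ a coloration of $Q_f$) in which each connected component $Q_i$ of $Q_f$ is colored according to the rules below, and the set of twisting maps $\tau:k[x]/(p(x))\otimes k^n\to k^n\otimes k[x]/(p(x))$. (All roots are roots in $k$.) (1) If $Q_i$ is a $1$-cycle, the loop vertex is colored by $0$, and any immediate predecessor (other than itself) of the loop vertex must be colored by a root of $q$. Given an immediate predecessor $e$ of the loop vertex colored by $r_1$, any other vertex $d$ in the same tree as $e$ must be colored by $r_1$ if $t$ is even, and by $r_2=-\alpha-r_1$ if $t$ is odd, where $t$ is the length of the path from $d$ to $e$. As a consequence, each connected component of this kind increases the number of twisting maps by at most a factor of $2^c$, where $c$ is the number of immediate predecessors (other than itself) of the loop vertex; and if $q$ has no roots in $k$, the only connected components of this kind that may show up are strict $1$-cycles. (2) If $Q_i$ is a strict $2$-cycle, its two vertices must be colored by $a,b\in k$ with $a+b=-\alpha$. Connected components of this kind give rise to a one-parameter family of twisting maps, the parameter ranging in the field. (3) If $Q_i$ is either a non-strict $2$-cycle or an $s$-cycle with $s>2$, any valid coloration is determined by choosing a coloration of the central cycle. Each vertex of the central cycle must be colored by roots of $q$ in alternating order, meaning that if a vertex is colored by a root $r_1$, any immediate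 predecessor and the immediate successor of that vertex are colored by $r_2=-\alpha-r_1$. Moreover, for any vertex $e$ in the cycle, the tree attached to $e$ is also colored by alternating roots of $q$: if $e$ is colored by $r_1$, any other vertex $d$ in the same tree as $e$ must be colored by $r_1$ if $t$ is even and by $r_2=-\alpha-r_1$ if $t$ is odd, where $t$ is the length of the path from $d$ to $e$. As a consequence, if $s$ is even there are as many colorations (of such a component) as different roots of $p$; and if $s$ is odd there exists a (unique) coloration if, and only if, $p$ has a unique root. In particular, components of this kind increase the number of twisting maps by at most a factor of $2$.
   Context: Algebras are unital associative $k$-algebras, maps are $k$-linear, $\otimes=\otimes_k$. For algebras $A,B$ a twisting map is a linear map $\tau:B\otimes A\to A\otimes B$ with $\tau\circ(B\otimes\mu_A)=(\mu_A\otimes B)\circ(A\otimes\tau)\circ(\tau\otimes A)$, $\tau\circ(\mu_B\otimes A)=(A\otimes\mu_B)\circ(\tau\otimes B)\circ(B\otimes\tau)$, $\tau(1\otimes a)=a\otimes1$, $\tau(b\otimes1)=1\otimes b$. A twisting map $\tau:k[x]/(p(x))\otimes A\to A\otimes k[x]/(p(x))$ is determined by the pair $(f,\delta)$ with $\tau(x\otimes a)=\delta(a)\otimes1+f(a)\otimes x$, where $f$ is an algebra endomorphism of $A$ and $\delta$ a left $f$-derivation. Let $\{e_1,\dots,e_n\}$ be the canonical basis of $k^n$. A set map $\varphi:\{e_1,\dots,e_n\}\to\{e_1,\dots,e_n\}$ determines the algebra endomorphism $f(e_i)=\sum_{\varphi(e_j)=e_i}e_j$ (all algebra endomorphisms arise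 uniquely this way) and the quiver $Q_f$ with vertices $e_1,\dots,e_n$ and one arrow $e_i\to\varphi(e_i)$ for each $i$. A vertex with $\varphi(e_i)=e_i$ is a loop vertex. A coloration of $Q_f$ is an element $a=(a_1,\dots,a_n)\in k^n$ with $a_i=0$ for each loop vertex $e_i$; $a_i$ is the color of $e_i$. It determines the $f$-derivation $\delta(e_i)=(f(e_i)-e_i)a=\sum_{\varphi(e_j)=e_i}a_je_j-a_ie_i$. Let $\tau_{\varphi,a}$ be the linear map with $\tau_{\varphi,a}(1\otimes b)=b\otimes 1$ and $\tau_{\varphi,a}(x\otimes b)=\delta(b)\otimes1+f(b)\otimes x$. Each connected component of $Q_f$ contains exactly one oriented cycle (the central cycle); it is called an $s$-cycle if the central cycle has $s$ vertices. Deleting the arrows of the central cycle leaves $s$ disjoint trees, each oriented towards its vertex on the cycle; these are the trees attached to the cycle vertices. For a $1$-cycle, ''the same tree as $e$'', where $e$ is an immediate predecessor of the loop vertex, means the set of vertices having an oriented path to $e$. A component is a strict $s$-cycle if it consists only of its central cycle (a strict $1$-cycle is a single vertex with a loop; a strict $2$-cycle is the round-trip quiver with two vertices and one arrow in each direction). An immediate predecessor of a vertex $v$ is a vertex with an arrow to $v$; the immediate successor of $v$ is $\varphi(v)$. *)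

(* Defs.v *)
From HB Require Import structures.
From mathcomp Require Import all_boot all_order all_algebra.
From mathcomp Require Import boolp classical_sets functions cardinality.

Set Implicit Arguments.
Unset Strict Implicit.
Unset Printing Implicit Defensive.

Import GRing.Theory VectorInternalTheory.
Local Open Scope ring_scope.

Section Tensor.

Variable k : fieldType.

(* U (x) V is modelled by the matrices of coordinates on the products of the
   vectors of the coordinate bases of U and V; [tliftE] and [tens_ext] are its
   universal property. *)
Definition tens (U V : vectType k) : vectType k := 'M[k]_(dim U, dim V).

Definition pure (U V : vectType k) (u : U) (v : V) : tens U V :=
  (v2r u)^T *m v2r v.

Section Lift.

Variables (U V W : vectType k) (b : U -> V -> W).

Definition tlift_fun (M : tens U V) : W :=
  \sum_i \sum_j (M : 'M[k]_(_, _)) i j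
    *: b (r2v (delta_mx 0 i)) (r2v (delta_mx 0 j)).

Fact tlift_fun_linear : linear tlift_fun.
Proof.
move=> c M N; rewrite /tlift_fun scaler_sumr -big_split; apply: eq_bigr => i _.
rewrite scaler_sumr -big_split; apply: eq_bigr => j _ /=.
by rewrite !mxE scalerDl scalerA.
Qed.

HB.instance Definition _ :=
  GRing.isLinear.Build k (tens U V) W _ tlift_fun tlift_fun_linear.

(* The linear map U (x) V -> W induced by b, when b is bilinear. *)
Definition tlift : 'Hom(tens U V, W) := linfun tlift_fun.

Lemma tliftE : (forall v, linear (b^~ v)) -> (forall u, linear (b u)) ->
  forall u v, tlift (pure u v) = b u v.
Proof.
move=> bl br u v; rewrite lfunE /=.
pose bL v := HB.pack_for {linear U -> W} (b^~ v)
  (GRing.isLinear.Build k U W _ (b^~ v) (bl v)).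
pose bR u := HB.pack_for {linear V -> W} (b u)
  (GRing.isLinear.Build k V W _ (b u) (br u)).
have [eu ev] : u = \sum_i v2r u 0 i *: r2v (delta_mx 0 i)
            /\ v = \sum_j v2r v 0 j *: r2v (delta_mx 0 j).
  split; apply: v2r_inj; rewrite [LHS]row_sum_delta linear_sum;
  by apply: eq_bigr => i _; rewrite linearZ /= r2vK.
have -> : b u v = bL v u by [].
rewrite [in RHS]eu linear_sum; apply: eq_bigr => i _; rewrite linearZ /=.
have -> : b (r2v (delta_mx 0 i)) v = bR (r2v (delta_mx 0 i)) v by [].
rewrite [in RHS]ev linear_sum scaler_sumr; apply: eq_bigr => j _.
by rewrite linearZ /= scalerA !mxE big_ord1 mxE.
Qed.

End Lift.

Lemma pureDl (U V : vectType k) (v : V) : linear (fun u : U => pure u v).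
Proof. by move=> c u u'; rewrite /pure !linearP mulmxDl -scalemxAl. Qed.

Lemma pureDr (U V : vectType k) (u : U) : linear (pure u : V -> tens U V).
Proof. by move=> c v v'; rewrite /pure linearP mulmxDr -scalemxAr. Qed.

Lemma tens_ext (U V W : vectType k) (f g : 'Hom(tens U V, W)) :
  (forall u v, f (pure u v) = g (pure u v)) -> f = g.
Proof.
move=> fg; apply/lfunP => M; rewrite [M]matrix_sum_delta !linear_sum.
apply: eq_bigr => i _; rewrite !linear_sum; apply: eq_bigr => j _.
rewrite !linearZ /=; congr (_ *: _).
have := fg (r2v (delta_mx 0 i)) (r2v (delta_mx 0 j)).
by rewrite /pure !r2vK trmx_delta mul_delta_mx.
Qed.

Definition tmap (U V U' V' : vectType k) (f : 'Hom(U, U')) (g : 'Hom(V, V')) :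
    'Hom(tens U V, tens U' V') :=
  tlift (fun u v => pure (f u) (g v)).

Definition tassoc (U V W : vectType k) :
    'Hom(tens (tens U V) W, tens U (tens V W)) :=
  tlift (fun uv w => tlift (fun u v => pure u (pure v w)) uv).

Definition tassoc_inv (U V W : vectType k) :
    'Hom(tens U (tens V W), tens (tens U V) W) :=
  tlift (fun u vw => tlift (fun v w => pure (pure u v) w) vw).

Lemma tmapE (U V U' V' : vectType k) (f : 'Hom(U, U')) (g : 'Hom(V, V')) u v :
  tmap f g (pure u v) = pure (f u) (g v).
Proof.
by rewrite tliftE // => [w|w] c x y; rewrite linearP ?pureDl ?pureDr.
Qed.

Lemma tassocE (U V W : vectType k) (u : U) (v : V) (w : W) :
  tassoc U V W (pure (pure u v) w) = pure u (pure v w).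
Proof.
have E w' u' v' : tlift (fun (u : U) (v : V) => pure u (pure v w' : tens V W))
    (pure u' v') = pure u' (pure v' w').
  by rewrite tliftE // => x c y z; rewrite ?pureDl // pureDr.
rewrite tliftE ?E // => [w'|M] c x y; first exact: linearP.
rewrite -scale_lfunE -add_lfunE; congr (fun_of_lfun _ M).
by apply: tens_ext => u' v'; rewrite add_lfunE scale_lfunE !E !pureDr.
Qed.

Lemma tassoc_invE (U V W : vectType k) (u : U) (v : V) (w : W) :
  tassoc_inv U V W (pure u (pure v w)) = pure (pure u v) w.
Proof.
have E u' v' w' : tlift (fun (v : V) (w : W) => pure (pure u' v : tens U V) w)
    (pure v' w') = pure (pure u' v') w'.
  by rewrite tliftE // => x c y z; rewrite ?pureDr // pureDl.
rewrite tliftE ?E // => [M|u'] c x y; last exact: linearP.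
rewrite -scale_lfunE -add_lfunE; congr (fun_of_lfun _ M).
by apply: tens_ext => v' w'; rewrite add_lfunE scale_lfunE !E !pureDl.
Qed.

(* A and B are finite-dimensional algebras, given by product and unit. *)

Section Twisting.

Variables (A B : vectType k).
Variables (mulA : A -> A -> A) (oneA : A) (mulB : B -> B -> B) (oneB : B).

Let muA : 'Hom(tens A A, A) := tlift mulA.
Let muB : 'Hom(tens B B, B) := tlift mulB.
Let idA : 'Hom(A, A) := \1%VF.
Let idB : 'Hom(B, B) := \1%VF.

Definition twisting_map (tau : 'Hom(tens B A, tens A B)) : Prop :=
  [/\ (* tau o (B (x) mu_A) = (mu_A (x) B) o (A (x) tau) o (tau (x) A) *)
      (tau \o tmap idB muA =
         tmap muA idB \o (tassoc_inv A A B \o (tmap idA tau \o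
           (tassoc A B A \o (tmap tau idA \o tassoc_inv B A A)))))%VF,
      (* tau o (mu_B (x) A) = (A (x) mu_B) o (tau (x) B) o (B (x) tau) *)
      (tau \o tmap muB idA =
         tmap idA muB \o (tassoc A B B \o (tmap tau idB \o
           (tassoc_inv B A B \o (tmap idB tau \o tassoc B B A)))))%VF,
      (forall a : A, tau (pure oneB a) = pure a oneB) &
      (forall b : B, tau (pure b oneA) = pure oneA b)].

End Twisting.

End Tensor.

(* k^o is k, seen as a vector space over itself. *)
Definition kpow (k : fieldType) (n : nat) : vectType k := {ffun 'I_n -> k^o}.

Section Tau.

Variables (k : fieldType) (alpha beta : k) (n : nat).

Definition p_poly : {poly k} := 'X^2 - alpha *: 'X + beta%:P.
Definition q_poly : {poly k} := 'X^2 + alpha *: 'X + beta%:P.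

Definition quot : vectType k := {poly %/ p_poly}.

Definition is_twisting : 'Hom(tens quot (kpow k n), tens (kpow k n) quot) -> Prop :=
  twisting_map (fun a b : {ffun 'I_n -> k^o} => a * b) [ffun=> 1]
               (fun u v : {poly %/ p_poly} => u * v) (1 : {poly %/ p_poly}).

Definition ebasis (i : 'I_n) : {ffun 'I_n -> k^o} := [ffun j => (j == i)%:R].

(* The vertex e_i is represented by its index i. *)
Variables (phi : {ffun 'I_n -> 'I_n}) (a : {ffun 'I_n -> k^o}).

(* f(e_i) = \sum_(phi(e_j) = e_i) e_j *)
Definition fmap (b : {ffun 'I_n -> k^o}) : {ffun 'I_n -> k^o} :=
  \sum_i b i *: \sum_(j | phi j == i) ebasis j.

Definition fder (b : {ffun 'I_n -> k^o}) : {ffun 'I_n -> k^o} :=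
  (fmap b - b) * a.

(* An element of k[x]/(p) is the class of u_0 + u_1 x for unique u_0, u_1. *)
Definition tau_map : 'Hom(tens quot (kpow k n), tens (kpow k n) quot) :=
  tlift (fun (u : quot) (b : kpow k n) =>
    ((u : {poly %/ p_poly}) : {poly k})`_0 *: pure b (1 : {poly %/ p_poly}) +
    ((u : {poly %/ p_poly}) : {poly k})`_1 *:
      (pure (fder b : kpow k n) (1 : {poly %/ p_poly}) +
       pure (fmap b : kpow k n) ('qX : {poly %/ p_poly}))).

End Tau.

Section TauFacts.

Variables (k : fieldType) (alpha beta : k) (n : nat).
Variables (phi : {ffun 'I_n -> 'I_n}) (a : {ffun 'I_n -> k^o}).

Lemma size_p_poly : size (p_poly alpha beta) = 3.
Proof.
rewrite /p_poly -addrA size_polyDl size_polyXn // ltnS.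
rewrite (leq_trans (size_polyD _ _)) // geq_max size_polyN.
by rewrite (leq_trans (size_scale_leq _ _)) ?size_polyX // (leq_trans (size_polyC_leq1 _)).
Qed.

Lemma monic_p_poly : p_poly alpha beta \is monic.
Proof.
rewrite monicE lead_coefE size_p_poly /p_poly !coefE /=.
by rewrite mulr0 subr0 addr0.
Qed.

Lemma mk_monic_p_poly : mk_monic (p_poly alpha beta) = p_poly alpha beta.
Proof. by rewrite /mk_monic size_p_poly monic_p_poly. Qed.

Lemma fmapE (b : {ffun 'I_n -> k^o}) j : fmap phi b j = b (phi j).
Proof.
rewrite /fmap sum_ffunE (bigD1 (phi j)) //= [X in _ + X]big1 ?addr0.
  rewrite ffunE sum_ffunE (bigD1 j) //= ffunE eqxx big1 ?addr0 => [|i].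
    by rewrite -[_ *: _]/(_ * _) mulr1.
  by rewrite ffunE => /andP[_ /negPf]; rewrite eq_sym => ->.
move=> i ni; rewrite ffunE sum_ffunE big1 ?scaler0 // => l /eqP ei.
rewrite ffunE; case: eqP => // jl; case/eqP: ni; by rewrite jl ei.
Qed.

Lemma fderE (b : {ffun 'I_n -> k^o}) j : fder phi a b j = (b (phi j) - b j) * a j.
Proof. by rewrite /fder !ffunE fmapE. Qed.

Lemma fmap_ebasis i : fmap phi (ebasis k i) = \sum_(j | phi j == i) ebasis k j.
Proof.
rewrite /fmap (bigD1 i) //= ffunE eqxx scale1r [X in _ + X]big1 ?addr0 // => j /negPf nij.
by rewrite ffunE nij scale0r.
Qed.

Lemma fder_ebasis i : fder phi a (ebasis k i) =
  \sum_(j | phi j == i) a j *: ebasis k j - a i *: ebasis k i.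
Proof.
rewrite /fder fmap_ebasis; apply/ffunP => l; rewrite !ffunE !sum_ffunE mulrBl.
congr (_ - _); last first.
  by rewrite -[RHS]/(_ * _) mulrC; case: eqP => [->|_] //; rewrite !mulr0.
rewrite mulr_suml; apply: eq_bigr => j _; rewrite !ffunE -[RHS]/(_ * _) mulrC.
by case: eqP => [->|_] //; rewrite !mulr0.
Qed.

Lemma fmap_linear : linear (fmap phi : {ffun 'I_n -> k^o} -> _).
Proof. by move=> c x y; apply/ffunP => j; rewrite !ffunE !fmapE !ffunE. Qed.

Lemma fder_linear : linear (fder phi a).
Proof.
move=> c x y; rewrite /fder fmap_linear opprD addrACA -scalerBr mulrDl.
by congr (_ + _); apply/ffunP => j; rewrite !ffunE -mulrA.
Qed.

Lemma tau_mapE (u : {poly %/ p_poly alpha beta}) (b : {ffun 'I_n -> k^o}) :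
  tau_map alpha beta phi a (pure (u : quot alpha beta) (b : kpow k n)) =
    (u : {poly k})`_0 *: pure (b : kpow k n) (1 : {poly %/ p_poly alpha beta}) +
    (u : {poly k})`_1 *:
      (pure (fder phi a b : kpow k n) (1 : {poly %/ p_poly alpha beta}) +
       pure (fmap phi b : kpow k n) ('qX : {poly %/ p_poly alpha beta})).
Proof.
rewrite /tau_map tliftE // => [{}b|{}u] c x y.
  by rewrite !coefD !coefZ !scalerDl -!scalerA addrACA -!scalerDr.
rewrite fder_linear fmap_linear !pureDl.
rewrite [in RHS]scalerDr !scalerA [c * _`_0]mulrC [c * _`_1]mulrC -!scalerA.
rewrite [RHS]addrACA -!scalerDr; congr (_ + _).
by rewrite [X in _ *: X = _]addrACA -[X in _ *: (X + _) = _]scalerDr.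
Qed.

Lemma tau_map1 (b : {ffun 'I_n -> k^o}) :
  tau_map alpha beta phi a (pure (1 : {poly %/ p_poly alpha beta}) (b : kpow k n)) =
  pure (b : kpow k n) (1 : {poly %/ p_poly alpha beta}).
Proof. by rewrite tau_mapE /= !coefC /= scale1r scale0r addr0. Qed.

Lemma tau_mapX (b : {ffun 'I_n -> k^o}) :
  tau_map alpha beta phi a (pure ('qX : {poly %/ p_poly alpha beta}) (b : kpow k n)) =
    pure (fder phi a b : kpow k n) (1 : {poly %/ p_poly alpha beta}) +
    pure (fmap phi b : kpow k n) ('qX : {poly %/ p_poly alpha beta}).
Proof.
by rewrite tau_mapE qpolyXE ?size_p_poly ?monic_p_poly // !coefX scale0r add0r scale1r.
Qed.

End TauFacts.

Section Quiver.

Variables (n : nat) (phi : {ffun 'I_n -> 'I_n}).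

Definition qadj : rel 'I_n := fun i j => (phi i == j) || (phi j == i).

Definition qcomponents : {set {set 'I_n}} :=
  [set [set j | connect qadj i j] | i : 'I_n]%SET.

Definition on_cycle (v : 'I_n) : bool := fconnect phi (phi v) v.

Definition central_cycle (C : {set 'I_n}) : {set 'I_n} :=
  [set v in C | on_cycle v]%SET.

Definition strict (C : {set 'I_n}) : bool := C == central_cycle C.

(* [opath d e t]: the oriented path of length t starting at d ends at e. The
   arrow from v belongs to a central cycle exactly when v lies on a cycle, so
   [tree_path d e t] says that this path survives the deletion of the arrows of
   the central cycles: for e on a cycle, d lies in the tree attached to e. *)
Definition opath (d e : 'I_n) (t : nat) : Prop := iter t phi d = e.
Definition tree_path (d e : 'I_n) (t : nat) : Prop :=
  opath d e t /\ forall m, (m < t)%N -> ~~ on_cycle (iter m phi d).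

End Quiver.

Section Coloring.

Variables (k : fieldType) (alpha beta : k) (n : nat).
Variable phi : {ffun 'I_n -> 'I_n}.

Definition is_coloration (a : {ffun 'I_n -> k^o}) : Prop := forall i, phi i = i -> a i = 0.

Definition alternate (r : k) (t : nat) : k := if odd t then - alpha - r else r.

Definition one_cycle_rule (C : {set 'I_n}) (a : {ffun 'I_n -> k^o}) : Prop :=
  forall l, l \in central_cycle phi C ->
    a l = 0 /\
    forall e, phi e = l -> e <> l ->
      root (q_poly alpha beta) (a e) /\
      forall d t, opath phi d e t -> a d = alternate (a e) t.

Definition strict_two_cycle_rule (C : {set 'I_n}) (a : {ffun 'I_n -> k^o}) : Prop :=
  forall v w, v \in C -> w \in C -> v <> w -> a v + a w = - alpha.

(* The part of [alternating_rule] that only involves the central cycle. *)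
Definition cycle_rule (C : {set 'I_n}) (a : {ffun 'I_n -> k^o}) : Prop :=
  forall v, v \in central_cycle phi C ->
    root (q_poly alpha beta) (a v) /\ a (phi v) = - alpha - a v.

Definition alternating_rule (C : {set 'I_n}) (a : {ffun 'I_n -> k^o}) : Prop :=
  [/\ cycle_rule C a,
      (forall v u, v \in central_cycle phi C -> phi u = v ->
         a u = - alpha - a v) &
      (forall e d t, e \in central_cycle phi C -> tree_path phi d e t ->
         a d = alternate (a e) t)].

Definition component_rule (C : {set 'I_n}) (a : {ffun 'I_n -> k^o}) : Prop :=
  if #|central_cycle phi C| == 1 then one_cycle_rule C a
  else if (#|central_cycle phi C| == 2) && strict phi C then strict_two_cycle_rule C a
  else alternating_rule C a.

Definition well_colored (a : {ffun 'I_n -> k^o}) : Prop :=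
  is_coloration a /\ forall C, C \in qcomponents phi -> component_rule C a.

(* The colorations of the component C alone (extended by 0 outside C). *)
Definition component_colorations (C : {set 'I_n}) : set {ffun 'I_n -> k^o} :=
  [set a : {ffun 'I_n -> k^o} | (forall i, i \notin C -> a i = 0) /\ component_rule C a]%classic.

(* The twisting maps with quiver Q_f whose coloration agrees with a outside C:
   their number, for fixed a, is the factor by which the component C increases
   the number of twisting maps. *)
Definition twistings_over (C : {set 'I_n}) (a : {ffun 'I_n -> k^o}) :
    set 'Hom(tens (quot alpha beta) (kpow k n), tens (kpow k n) (quot alpha beta)) :=
  [set tau | is_twisting tau /\
     exists b, [/\ is_coloration b, (forall i, i \notin C -> b i = a i) &
                   tau = tau_map alpha beta phi b]]%classic.

End Coloring.

Arguments twistings_over {k} alpha beta {n} phi C a.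

(* Main.v *)
Require Import Defs.
From HB Require Import structures.
From mathcomp Require Import all_boot all_order all_algebra.
From mathcomp Require Import boolp classical_sets functions cardinality.
From mathcomp Require Import ring.

Set Implicit Arguments.
Unset Strict Implicit.
Unset Printing Implicit Defensive.

Import GRing.Theory VectorInternalTheory.
Local Open Scope ring_scope.
Local Open Scope card_scope.

(** A tensor in A (x) k[x]/(p) is a (x) 1 + b (x) x for unique a and b, so a map
    tau with tau (1 (x) b) = b (x) 1 is the same thing as a pair (delta, f) with
    tau (x (x) b) = delta b (x) 1 + f b (x) x.  Comparing coefficients, tau is
    a twisting map exactly when f is a unital algebra endomorphism, delta is an
    f-derivation killing 1, and the relation x^2 = alpha x - beta is respected:
      delta^2 - beta f^2 = alpha delta - beta,
      f delta + delta f + alpha f^2 = alpha f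
    ([twisting_oneP], [twisting_mulAP], [twisting_mulBP]).

    On k^n every such f comes from a map phi of the vertices and every such
    delta from a coloration a ([is_twistingE]).  At the vertex j, the
    two sides of each equation, applied to b, differ by a combination of
      (b (phi^2 j) - b (phi j)) (a (phi j) + a j + alpha)   and
      (b (phi^2 j) - b j) q(a j).
    So tau_(phi, a) is a twisting map exactly when, at every vertex j,
      phi^2 j <> phi j implies a (phi j) + a j = - alpha, and
      phi^2 j <> j implies q(a j) = 0
    ([is_twisting_tau_map]).  This condition is local, and the coloring rules
    are what it becomes on a connected component, according to its central
    cycle ([component_ruleP]): the exception phi^2 j = phi j occurs only at a
    loop vertex and at its immediate predecessors, and the exception
    phi^2 j = j only on cycles of length at most 2.

    The counts follow because r |-> - alpha - r is an involution of the roots of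
    q, which has no other root than r and - alpha - r: away from a loop, the
    color of a vertex is the image under this involution of the color of its
    successor.  On a 1-cycle a coloring is thus determined by one root for each
    immediate predecessor of the loop, and on a component with neither a loop
    nor only a round trip by one root in all.  Going once around a cycle
    of odd length forces that root to be fixed by the involution, that is, to be
    the only one. *)

(** * Bilinearity of the tensor product *)

Section PureBilinear.

Variables (k : fieldType) (U V : vectType k).
Implicit Types (u : U) (v : V) (c : k).

Lemma pure_addl u u' v : pure (u + u') v = pure u v + pure u' v.
Proof. by rewrite /pure !linearD mulmxDl. Qed.

Lemma pure_scalel c u v : pure (c *: u) v = c *: pure u v.
Proof. by rewrite /pure !linearZ -scalemxAl. Qed.

Lemma pure_addr u v v' : pure u (v + v') = pure u v + pure u v'.
Proof. by rewrite /pure !linearD. Qed.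

Lemma pure_scaler c u v : pure u (c *: v) = c *: pure u v.
Proof. by rewrite /pure !linearZ. Qed.

(** The two partial applications of the tensor product, named so that they can
    carry a linear structure and be composed with linear maps. *)
Definition purel v u : tens U V := pure u v.
HB.instance Definition _ v :=
  GRing.isLinear.Build k U (tens U V) _ (purel v) (pureDl v).

Definition purer u v : tens U V := pure u v.
HB.instance Definition _ u :=
  GRing.isLinear.Build k V (tens U V) _ (purer u) (@pureDr k U V u).

End PureBilinear.

Lemma tens_ext_purel (k : fieldType) (U U' V W : vectType k)
    (F G : 'Hom(tens (tens U U') V, W)) v :
  (forall u u', F (pure (pure u u') v) = G (pure (pure u u') v)) ->
  forall M, F (pure M v) = G (pure M v).
Proof.
move=> E M; suff E' : (F \o linfun (purel v) = G \o linfun (purel v))%VF.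
  by have := congr1 (fun h : 'Hom(_, _) => h M) E'; rewrite /= !comp_lfunE !lfunE.
by apply: tens_ext => u u'; rewrite !comp_lfunE !lfunE; apply: E.
Qed.

Lemma tens_ext_purer (k : fieldType) (U V V' W : vectType k)
    (F G : 'Hom(tens U (tens V V'), W)) u :
  (forall v v', F (pure u (pure v v')) = G (pure u (pure v v'))) ->
  forall M, F (pure u M) = G (pure u M).
Proof.
move=> E M; suff E' : (F \o linfun (purer u) = G \o linfun (purer u))%VF.
  by have := congr1 (fun h : 'Hom(_, _) => h M) E'; rewrite /= !comp_lfunE !lfunE.
by apply: tens_ext => v v'; rewrite !comp_lfunE !lfunE; apply: E.
Qed.

(** * The quotient k[x]/(p) with basis 1, x *)

Section Quotient.

Variables (k : fieldType) (alpha beta : k).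

Notation Q := (quot alpha beta).

Definition qone : Q := (1 : {poly %/ p_poly alpha beta}).
Definition qx : Q := ('qX : {poly %/ p_poly alpha beta}).
Definition qcoef (u : Q) (i : nat) : k := ((u : {poly %/ p_poly alpha beta}) : {poly k})`_i.
Definition qmul (u v : Q) : Q :=
  (u : {poly %/ p_poly alpha beta}) * (v : {poly %/ p_poly alpha beta}).

Lemma qcoef_linear i : linear (qcoef^~ i : Q -> k^o).
Proof. by move=> c u v; rewrite /qcoef !coefD !coefZ. Qed.

Lemma qcoef_one i : qcoef qone i = (i == 0)%:R.
Proof. by rewrite /qcoef /qone /= coefC; case: eqP. Qed.

Lemma qcoef_x i : qcoef qx i = (i == 1)%:R.
Proof.
by rewrite /qcoef /qx qpolyXE ?size_p_poly ?monic_p_poly // coefX.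
Qed.

Lemma quotE (u : Q) : u = qcoef u 0 *: qone + qcoef u 1 *: qx.
Proof.
apply/npolyP => i.
have -> : (u : {poly %/ p_poly alpha beta})`_i = qcoef u i by [].
have -> : (qcoef u 0 *: qone + qcoef u 1 *: qx : {poly %/ p_poly alpha beta})`_i
   = qcoef (qcoef u 0 *: qone + qcoef u 1 *: qx) i by [].
rewrite qcoef_linear -[qcoef u 1 *: qx]addr0 qcoef_linear qcoef_one qcoef_x.
have -> : qcoef 0 i = 0 by rewrite /qcoef coef0.
rewrite addr0.
case: i => [|[|i]] /=; rewrite -?[_ *: 1]/(_ * 1) -?[_ *: 0]/(_ * 0);
  rewrite ?mulr1 ?mulr0 ?add0r ?addr0 //.
by rewrite /qcoef big_coef_npoly // mk_monic_p_poly size_p_poly.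
Qed.

Lemma qmulE : (forall u, qmul qone u = u) /\ (forall u, qmul u qone = u).
Proof. by split=> u; rewrite /qmul ?mul1r ?mulr1. Qed.

Lemma qmulxx : qmul qx qx = alpha *: qx - beta *: qone.
Proof.
pose p := p_poly alpha beta.
have p0 : in_qpoly p p = 0.
  by apply/val_inj; rewrite /= mk_monic_p_poly Pdiv.Ring.rmodpp // /GRing.comm mulrC.
have -> : qmul qx qx = in_qpoly p 'X^2 by rewrite in_qpolyM.
have -> : alpha *: qx - beta *: qone = in_qpoly p (alpha *: 'X - beta%:P).
  by rewrite linearB -[beta%:P]mulr1 mul_polyC !linearZ /= in_qpoly1.
apply/eqP; rewrite -subr_eq0 -linearB /= -p0; apply/eqP; congr (in_qpoly p _).
by rewrite /p /p_poly opprB addrA addrAC.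
Qed.

Lemma qmul_bilinear : (forall v, linear (qmul^~ v)) /\ (forall u, linear (qmul u)).
Proof.
split=> v c x y; rewrite /qmul.
  by rewrite mulrDl; congr (_ + _); rewrite scalerAl.
by rewrite mulrDr; congr (_ + _); rewrite scalerAr.
Qed.

End Quotient.

(** * Components of a tensor along 1 and x *)

Section Components.

Variables (k : fieldType) (alpha beta : k) (A : vectType k).

Notation Q := (quot alpha beta).
Notation qone := (qone alpha beta).
Notation qx := (qx alpha beta).

Definition tcoef (i : nat) : 'Hom(tens A Q, A) :=
  tlift (fun a u => qcoef u i *: a).

Lemma tcoefE i a u : tcoef i (pure a u) = qcoef u i *: a.
Proof.
rewrite tliftE // => [{}u|{}a] c x y.
  by rewrite scalerDr !scalerA mulrC.
by rewrite qcoef_linear scalerDl scalerA.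
Qed.

Lemma tcoef0E a b : tcoef 0 (pure a qone + pure b qx) = a.
Proof. by rewrite linearD /= !tcoefE qcoef_one qcoef_x scale1r scale0r addr0. Qed.

Lemma tcoef1E a b : tcoef 1 (pure a qone + pure b qx) = b.
Proof. by rewrite linearD /= !tcoefE qcoef_one qcoef_x scale1r scale0r add0r. Qed.

Lemma tensE (M : tens A Q) : M = pure (tcoef 0 M) qone + pure (tcoef 1 M) qx.
Proof.
suff E : (\1 = (linfun (purel qone) \o tcoef 0) + (linfun (purel qx) \o tcoef 1))%VF.
  rewrite -[LHS]id_lfunE E add_lfunE !comp_lfunE.
  by rewrite [linfun (purel qone) _]lfunE [linfun (purel qx) _]lfunE.
apply: tens_ext => a u; rewrite id_lfunE add_lfunE !comp_lfunE !tcoefE !lfunE /= /purel.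
by rewrite {1}[u]quotE pure_addr !pure_scaler !pure_scalel.
Qed.

Lemma tens_inj (a b a' b' : A) :
  pure a qone + pure b qx = pure a' qone + pure b' qx -> a = a' /\ b = b'.
Proof.
move=> E; split; first by rewrite -[a](tcoef0E a b) E tcoef0E.
by rewrite -[b](tcoef1E a b) E tcoef1E.
Qed.

Lemma tensl_ext (V W : vectType k) (F G : 'Hom(tens Q V, W)) :
  (forall v, F (pure qone v) = G (pure qone v)) ->
  (forall v, F (pure qx v) = G (pure qx v)) -> F = G.
Proof.
move=> E1 Ex; apply: tens_ext => u v.
by rewrite [u]quotE pure_addl !pure_scalel !linearD !linearZ /= E1 Ex.
Qed.

End Components.

(** * Twisting maps for k[x]/(p) in terms of delta and f *)

Section QuadraticTwisting.

Variables (k : fieldType) (alpha beta : k) (A : vectType k).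
Variables (mulA : A -> A -> A) (oneA : A).
Hypotheses (mulAl : forall b, linear (mulA^~ b)) (mulAr : forall b, linear (mulA b)).

Notation Q := (quot alpha beta).
Notation qone := (qone alpha beta).
Notation qx := (qx alpha beta).

Variables (tau : 'Hom(tens Q A, tens A Q)) (delta f : 'End(A)).
Hypothesis tau1 : forall b, tau (pure qone b) = pure b qone.
Hypothesis taux : forall b, tau (pure qx b) = pure (delta b) qone + pure (f b) qx.

Let muE u v : tlift (qmul (beta := beta) (alpha := alpha)) (pure u v) = qmul u v.
Proof. by case: (qmul_bilinear alpha beta) => ? ?; rewrite tliftE. Qed.

Let mulAE u v : tlift mulA (pure u v) = mulA u v.
Proof. by rewrite tliftE. Qed.

Lemma twisting_oneP :
  (forall u : Q, tau (pure u oneA) = pure oneA u) <-> delta oneA = 0 /\ f oneA = oneA.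
Proof.
split=> [E|[d1 f1] u].
  apply: (@tens_inj _ alpha beta).
  by rewrite -taux E -[X in pure X qone](scale0r 0) pure_scalel scale0r add0r.
rewrite {1}[u]quotE pure_addl !pure_scalel linearD !linearZ /= tau1 taux d1 f1.
rewrite -[X in pure X qone + _](scale0r 0) pure_scalel scale0r add0r.
by rewrite {3}[u]quotE pure_addr !pure_scaler.
Qed.

(** At 1 (x) b (x) c both sides are bc (x) 1; at x (x) b (x) c the two sides have
    the components delta (bc), f (bc) and delta b c + f b delta c, f b f c. *)
Lemma twisting_mulAP :
  (tau \o tmap \1 (tlift mulA) =
         tmap (tlift mulA) \1 \o (tassoc_inv A A Q \o (tmap \1 tau \o
           (tassoc A Q A \o (tmap tau \1 \o tassoc_inv Q A A)))))%VF <->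
  (forall b c, f (mulA b c) = mulA (f b) (f c)) /\
  (forall b c, delta (mulA b c) = mulA (delta b) c + mulA (f b) (delta c)).
Proof.
set L := (tau \o _)%VF; set R := (_ \o (_ \o _))%VF.
have Lx b c : L (pure qx (pure b c)) = pure (delta (mulA b c)) qone + pure (f (mulA b c)) qx.
  by rewrite /L comp_lfunE tmapE mulAE id_lfunE taux.
have Rx b c : R (pure qx (pure b c)) =
    pure (mulA (delta b) c + mulA (f b) (delta c)) qone + pure (mulA (f b) (f c)) qx.
  rewrite /R !comp_lfunE tassoc_invE tmapE taux id_lfunE pure_addl.
  rewrite !linearD /= !tassocE !tmapE !id_lfunE !tau1 !taux pure_addr !linearD /=.
  by rewrite !tassoc_invE !tmapE !id_lfunE !mulAE pure_addl addrA.
split=> [E|[mf md]].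
  by split=> b c; have := Lx b c; rewrite E Rx => /tens_inj[].
apply: tensl_ext; apply: tens_ext_purer => b c; last by rewrite Lx Rx mf md.
rewrite /L /R !comp_lfunE.
rewrite tassoc_invE !tmapE !id_lfunE !tau1 tassocE tmapE tau1 id_lfunE.
by rewrite tassoc_invE tmapE !mulAE id_lfunE.
Qed.

(** Only x (x) x (x) b carries information: there the right-hand side is
    delta^2 b (x) 1 + (f delta b + delta f b) (x) x + f^2 b (x) x^2, and the
    equations come from x^2 = alpha x - beta on both sides. *)
Lemma twisting_mulBP :
  (tau \o tmap (tlift (qmul (alpha := alpha) (beta := beta))) \1 =
         tmap \1 (tlift (qmul (alpha := alpha) (beta := beta))) \o
           (tassoc A Q Q \o (tmap tau \1 \o
             (tassoc_inv Q A Q \o (tmap \1 tau \o tassoc Q Q A)))))%VF <->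
  forall b, delta (delta b) - beta *: f (f b) = alpha *: delta b - beta *: b /\
            f (delta b) + delta (f b) + alpha *: f (f b) = alpha *: f b.
Proof.
set L := (tau \o _)%VF; set R := (_ \o (_ \o _))%VF.
have [m1 m2] := qmulE alpha beta.
have Lx b : L (pure (pure qx qx) b) =
    pure (alpha *: delta b - beta *: b) qone + pure (alpha *: f b) qx.
  rewrite /L comp_lfunE tmapE muE id_lfunE qmulxx -!scaleNr !pure_addl !pure_scalel.
  by rewrite linearD !linearZ /= taux tau1 scalerDr addrAC.
have Rx b : R (pure (pure qx qx) b) =
    pure (delta (delta b) - beta *: f (f b)) qone +
    pure (f (delta b) + delta (f b) + alpha *: f (f b)) qx.
  rewrite /R !comp_lfunE tassocE tmapE id_lfunE taux -scaleNr.
  rewrite pure_addr !linearD /= !tassoc_invE !tmapE !id_lfunE !taux !pure_addl !linearD /=.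
  rewrite !tassocE !tmapE !id_lfunE !muE.
  rewrite !m1 m2 qmulxx -!scaleNr !pure_addr !pure_scaler !pure_scalel.
  rewrite -!addrA; congr (_ + _); rewrite [RHS]addrCA; congr (_ + _).
  by rewrite [RHS]addrCA; congr (_ + _); rewrite addrC.
split=> [E b|H].
  by have := Lx b; rewrite E Rx => /tens_inj[].
have qo b u : L (pure (pure qone u) b) = R (pure (pure qone u) b).
  rewrite /L /R !comp_lfunE tassocE !tmapE muE m1 !id_lfunE.
  rewrite [tau _]tensE pure_addr !linearD /= !tassoc_invE !tmapE !tau1 !id_lfunE !tassocE.
  by rewrite !tmapE !muE !id_lfunE !m1.
apply: tens_ext => uv b; apply: tens_ext_purel uv => u v.
rewrite [u]quotE !pure_addl !pure_scalel !linearD !linearZ /= qo.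
congr (_ + _ *: _).
rewrite [v]quotE pure_addr !pure_scaler pure_addl !pure_scalel !linearD !linearZ /=.
congr (_ *: _ + _ *: _); last by rewrite Lx Rx; case: (H b) => -> ->.
rewrite /L /R !comp_lfunE tassocE !tmapE muE !id_lfunE tau1 m2 tassoc_invE tmapE taux.
by rewrite pure_addl !linearD /= id_lfunE !tassocE !tmapE !id_lfunE !muE m1 m2.
Qed.

End QuadraticTwisting.

(** * Twisting maps on k^n *)

Section ColoredTwisting.

Variables (k : fieldType) (alpha beta : k) (n : nat).

Notation Q := (quot alpha beta).
Notation qone := (qone alpha beta).
Notation qx := (qx alpha beta).
Notation vec := {ffun 'I_n -> k^o}.

HB.instance Definition _ (phi : {ffun 'I_n -> 'I_n}) :=
  GRing.isLinear.Build k vec vec _ (fmap phi) (fmap_linear phi).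
HB.instance Definition _ (phi : {ffun 'I_n -> 'I_n}) a :=
  GRing.isLinear.Build k vec vec _ (fder phi a) (fder_linear phi a).

Lemma ebasisE (i j : 'I_n) : ebasis k i j = (j == i)%:R.
Proof. by rewrite ffunE. Qed.

(** Unlike [ffunE], these rules do not look inside [fmap] and [fder]. *)
Lemma vecE :
  ((forall (b c : vec) j, (b + c) j = b j + c j) *
   (forall (b : vec) j, (- b) j = - b j)) *
  ((forall x (b : vec) j, (x *: b) j = x * b j) *
   (forall (b c : vec) j, (b * c) j = b j * c j)).
Proof. by do 2!split=> *; rewrite ffunE. Qed.

Lemma root_q (r : k) : root (q_poly alpha beta) r = (r ^+ 2 + alpha * r + beta == 0).
Proof. by rewrite rootE /q_poly !hornerE. Qed.

Lemma is_twistingP (tau : 'Hom(tens Q (kpow k n), tens (kpow k n) Q))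
    (delta f : 'End(kpow k n)) :
  (forall b, tau (pure qone b) = pure b qone) ->
  (forall b, tau (pure qx b) = pure (delta b) qone + pure (f b) qx) ->
  is_twisting tau <->
  [/\ delta [ffun=> 1] = 0 /\ f [ffun=> 1] = [ffun=> 1],
      forall b c : vec, f (b * c) = (f b : vec) * (f c : vec),
      forall b c : vec, delta (b * c) = (delta b : vec) * c + (f b : vec) * (delta c : vec) &
      forall b, delta (delta b) - beta *: f (f b) = alpha *: delta b - beta *: b /\
            f (delta b) + delta (f b) + alpha *: f (f b) = alpha *: f b].
Proof.
move=> t1 tx; pose mulA (b c : kpow k n) : kpow k n := (b : vec) * (c : vec).
have lA : forall b, linear (mulA^~ b).
  move=> b c x y; rewrite /mulA mulrDl; congr (_ + _).
  by apply/ffunP => j; rewrite !ffunE; apply/esym/mulrA.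
have rA : forall b, linear (mulA b).
  move=> b c x y; rewrite /mulA mulrDr; congr (_ + _).
  by apply/ffunP => j; rewrite !ffunE; apply: mulrCA.
have P1 := twisting_oneP ([ffun=> 1] : vec) t1 tx.
have PA := twisting_mulAP lA rA t1 tx.
have PB := twisting_mulBP t1 tx.
split=> [[/PA[? ?] /PB ? _ /P1[? ?]]|[[d1 f1] mf md q]]; first by split.
by split; [exact/PA | exact/PB | exact: t1 | exact/P1].
Qed.

Definition edge_rule (phi : {ffun 'I_n -> 'I_n}) (a : vec) (j : 'I_n) : Prop :=
  (phi (phi j) <> phi j -> a (phi j) + a j = - alpha) /\
  (phi (phi j) <> j -> root (q_poly alpha beta) (a j)).

Lemma tau_map_qx phi (a : vec) b :
  tau_map alpha beta phi a (pure qx b) = pure (fder phi a b : kpow k n) qone +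
    pure (fmap phi b : kpow k n) qx.
Proof. exact: tau_mapX. Qed.

(** Testing the two equations on the idempotent at phi (phi j) isolates the two
    factors a (phi j) + a j + alpha and q(a j). *)
Lemma is_twisting_tau_map (phi : {ffun 'I_n -> 'I_n}) (a : vec) :
  is_twisting (tau_map alpha beta phi a) <-> forall j, edge_rule phi a j.
Proof.
pose dl : 'End(kpow k n) := linfun (fder phi a : kpow k n -> kpow k n).
pose fl : 'End(kpow k n) := linfun (fmap phi : kpow k n -> kpow k n).
have dE b : dl b = fder phi a b by rewrite lfunE.
have fE b : fl b = fmap phi b by rewrite lfunE.
have P := @is_twistingP (tau_map alpha beta phi a) dl fl.
rewrite {}P; [|exact: tau_map1|by move=> b; rewrite dE fE tau_map_qx].
split=> [[_ _ _ H] j|H].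
  have [] := H (ebasis k (phi (phi j))); rewrite !dE !fE => /ffunP/(_ j) E1 /ffunP/(_ j) E2.
  rewrite !(vecE, fderE, fmapE, ebasisE) eqxx in E1.
  rewrite !(vecE, fderE, fmapE, ebasisE) eqxx in E2.
  move/eqP: E1; rewrite -subr_eq0 => /eqP E1; move/eqP: E2; rewrite -subr_eq0 => /eqP E2.
  have R2 : phi (phi j) <> phi j -> a (phi j) + a j = - alpha.
    move=> /eqP; rewrite eq_sym => /negPf ne; rewrite ne /= in E2.
    by apply/eqP; rewrite -addr_eq0 -E2; apply/eqP; ring.
  split=> // /eqP; rewrite eq_sym => /negPf ne; rewrite root_q.
  rewrite ne in E1; apply/eqP; have [e|/eqP ne'] := eqVneq (phi j) (phi (phi j)).
    by rewrite -e eqxx /= in E1; rewrite -oppr0 -E1; ring.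
  have a1 : a (phi j) = - alpha - a j.
    by rewrite -R2 ?addrK // => /esym.
  by rewrite (negPf (introN eqP ne')) a1 /= in E1; rewrite -oppr0 -E1; ring.
split; first split.
- by rewrite dE; apply/ffunP => j; rewrite fderE !ffunE subrr mul0r.
- by rewrite fE; apply/ffunP => j; rewrite fmapE !ffunE.
- by move=> b c; rewrite !fE; apply/ffunP => j; rewrite !(vecE, fmapE).
- move=> b c; rewrite !fE !dE; apply/ffunP => j; rewrite !(vecE, fderE, fmapE).
  ring.
move=> b; rewrite !dE !fE.
(* For the products K and E below, the difference of the two sides at j is
   a j * K - E in the first equation and K in the second. *)
have K j : (b (phi (phi j)) - b (phi j)) * (a (phi j) + a j + alpha) = 0.
  have [->|/eqP ne] := eqVneq (phi (phi j)) (phi j); first by rewrite subrr mul0r.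
  by have [->] := H j; rewrite // addNr mulr0.
have E j : (b (phi (phi j)) - b j) * (a j ^+ 2 + alpha * a j + beta) = 0.
  have [->|/eqP ne] := eqVneq (phi (phi j)) j; first by rewrite subrr mul0r.
  by have [_] := H j; rewrite root_q => /(_ ne) /eqP ->; rewrite mulr0.
split; apply/ffunP => j; rewrite !(vecE, fderE, fmapE);
  apply/eqP; rewrite -subr_eq0; apply/eqP.
  transitivity (a j * 0 - 0 : k); last by rewrite mulr0 subr0.
  by rewrite -{1}(K j) -(E j) /=; ring.
by rewrite -(K j) /=; ring.
Qed.

Lemma tau_map_inj (phi phi' : {ffun 'I_n -> 'I_n}) (a a' : vec) :
  is_coloration phi a -> is_coloration phi' a' ->
  tau_map alpha beta phi a = tau_map alpha beta phi' a' -> phi = phi' /\ a = a'.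
Proof.
move=> ca ca' E.
have {E} Eb b : fder phi a b = fder phi' a' b /\ fmap phi b = fmap phi' b.
  apply: (@tens_inj k alpha beta (kpow k n)).
  apply: etrans (esym (tau_map_qx phi a b)) (etrans _ (tau_map_qx phi' a' b)).
  by rewrite E.
have Ephi : phi = phi'.
  apply/ffunP => j; have [_ /ffunP/(_ j)] := Eb (ebasis k (phi j)).
  rewrite !fmapE !ebasisE eqxx; case: (phi' j =P phi j) => [->//|_ /eqP].
  by rewrite oner_eq0.
split=> //; rewrite -Ephi in ca' Eb; apply/ffunP => j.
have [e|] := eqVneq (phi j) j; first by rewrite ca // ca'.
rewrite eq_sym => /negPf ne; have [/ffunP/(_ j)] := Eb (ebasis k (phi j)).
by rewrite !fderE !ebasisE eqxx ne subr0 !mul1r.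
Qed.

(** At each vertex j the values f(e_i) j are idempotents of k with sum 1, so
    some f(e_i) j is 1; then f b j = f (b e_i) j = b i. *)
Lemma algebra_endo_kpow (f : 'End(kpow k n)) :
  f [ffun=> 1] = [ffun=> 1] -> (forall b c : vec, f (b * c) = (f b : vec) * (f c : vec)) ->
  exists phi : {ffun 'I_n -> 'I_n}, forall b, f b = fmap phi b.
Proof.
move=> f1 mf.
have [phi phiP] : {phi : 'I_n -> 'I_n & forall j, (f (ebasis k (phi j)) : vec) j = 1}.
  apply: (choice (P := fun j i => (f (ebasis k i) : vec) j = 1)) => j.
  have idem i : ((f (ebasis k i) : vec) j == 0) || ((f (ebasis k i) : vec) j == 1).
    rewrite -[_ == 1]subr_eq0 -mulf_eq0 mulrBr mulr1 subr_eq0.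
    have -> : (f (ebasis k i) : vec) j * (f (ebasis k i) : vec) j
        = (f (ebasis k i * ebasis k i : vec) : vec) j by rewrite mf vecE.
    rewrite (_ : ebasis k i * ebasis k i = ebasis k i) //.
    by apply/ffunP => l; rewrite !(vecE, ebasisE); case: eqP => _; rewrite ?mulr0 ?mulr1.
  apply: contrapT => /forallNP none.
  have z i : (f (ebasis k i) : vec) j = 0.
    by case/orP: (idem i) => /eqP // /none.
  have : (f [ffun=> 1] : vec) j = 0.
    have -> : [ffun=> 1] = \sum_i ebasis k i :> kpow k n.
      apply/ffunP => l; rewrite sum_ffunE (bigD1 l) //= big1 ?addr0 => [|i].
        by rewrite !ffunE eqxx.
      by rewrite ebasisE eq_sym => /negPf->.
    by rewrite linear_sum sum_ffunE big1 // => i _; apply: z.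
  by rewrite f1 ffunE => /eqP; rewrite oner_eq0.
exists (finfun phi) => b; apply/ffunP => j; rewrite fmapE ffunE.
rewrite -[LHS]mulr1 -(phiP j) -[LHS]/((f b : vec) j * _).
have <- : (f (b * ebasis k (phi j) : vec) : vec) j =
    (f b : vec) j * (f (ebasis k (phi j)) : vec) j.
  by rewrite mf vecE.
have -> : b * ebasis k (phi j) = b (phi j) *: ebasis k (phi j) :> vec.
  apply/ffunP => l; rewrite !(vecE, ebasisE).
  by have [->|] := eqVneq l (phi j); rewrite ?mulr0.
by rewrite linearZ [LHS]vecE phiP mulr1.
Qed.

(** For phi j <> j, commutativity applied to b e_(phi j) = e_(phi j) b shows that
    delta b j is (b (phi j) - b j) times a constant, which is the color of j.
    At a loop vertex delta is a derivation at a point of k^n, hence 0. *)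
Lemma twisted_derivation_kpow (delta : 'End(kpow k n)) (phi : {ffun 'I_n -> 'I_n}) :
  delta [ffun=> 1] = 0 ->
  (forall b c : vec, delta (b * c) = (delta b : vec) * c + fmap phi b * (delta c : vec)) ->
  exists2 a, is_coloration phi a & forall b, delta b = fder phi a b.
Proof.
move=> d1 md.
have mdE b c j : (delta (b * c : vec) : vec) j =
    (delta b : vec) j * c j + b (phi j) * (delta c : vec) j.
  by rewrite md !(vecE, fmapE).
exists [ffun j => if phi j == j then 0 else (delta (ebasis k (phi j)) : vec) j].
  by move=> j e; rewrite ffunE e eqxx.
move=> b; apply/ffunP => j; rewrite fderE [X in _ * X]ffunE.
have [e|ne] := eqVneq (phi j) j.
  rewrite mulr0; set c := ebasis k j; have cj : c j = 1 by rewrite ebasisE eqxx.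
  have cM (x : vec) : x * c = x j *: c.
    apply/ffunP => l; rewrite !(vecE, ebasisE).
    by have [->|] := eqVneq l j; rewrite ?mulr0.
  have dc : (delta c : vec) j = 0.
    have := mdE c c j; rewrite cM cj scale1r e cj mul1r mulr1.
    by move=> /eqP; rewrite -subr_eq0 opprD addrA subrr sub0r oppr_eq0 => /eqP.
  have := mdE b c j; rewrite cM linearZ [X in X = _]vecE dc cj !mulr0 mulr1 addr0.
  by move=> <-.
set c := ebasis k (phi j).
have cj : c j = 0 by rewrite ebasisE eq_sym (negPf ne).
have cp : c (phi j) = 1 by rewrite ebasisE eqxx.
have bcC : b * c = c * b :> vec by apply/ffunP => l; rewrite !vecE; apply: mulrC.
have := mdE b c j; rewrite bcC mdE cj cp mulr0 add0r mul1r => bc.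
by rewrite mulrBl -bc; ring.
Qed.

Lemma is_twistingE tau : is_twisting (alpha := alpha) (beta := beta) (n := n) tau ->
  exists phi a, is_coloration phi a /\ tau = tau_map alpha beta phi a.
Proof.
move=> tt.
pose tc i : 'End(kpow k n) := (tcoef alpha beta (kpow k n) i \o (tau \o linfun (purer qx)))%VF.
have tcE i b : tc i b = tcoef alpha beta (kpow k n) i (tau (pure qx b)).
  by rewrite !comp_lfunE [linfun (purer _) _]lfunE.
have t1 b : tau (pure qone b) = pure b qone by case: tt => _ _ ->.
have tx b : tau (pure qx b) = pure (tc 0 b) qone + pure (tc 1 b) qx.
  rewrite !tcE; exact: tensE.
have [[d1 f1] mf md _] := (is_twistingP t1 tx).1 tt.
have [phi fE] := algebra_endo_kpow f1 mf.
have md' (b c : vec) : tc 0 (b * c) = (tc 0 b : vec) * c + fmap phi b * (tc 0 c : vec).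
  rewrite -fE; exact: md.
have [a ca dE] := twisted_derivation_kpow d1 md'.
exists phi, a; split=> //; apply: tensl_ext => b.
  by rewrite t1; apply/esym/tau_map1.
rewrite tx dE fE; apply/esym/tau_map_qx.
Qed.

End ColoredTwisting.

(** * Components and central cycles of the quiver of a map *)

Section QuiverFacts.

Local Open Scope nat_scope.

Variables (n : nat) (phi : {ffun 'I_n -> 'I_n}).

Lemma on_cycleP v : reflect (exists t, iter t.+1 phi v = v) (on_cycle phi v).
Proof.
apply: (iffP idP) => [cv|[t e]].
  by exists (findex phi (phi v) v); rewrite iterSr iter_findex.
by rewrite /on_cycle -{2}e iterSr fconnect_iter.
Qed.

Lemma on_cycle_iter v t : on_cycle phi v -> on_cycle phi (iter t phi v).
Proof.
move=> /on_cycleP[m e]; apply/on_cycleP; exists m.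
by rewrite -iterD addnC iterD e.
Qed.

(** n arrows leave any tree, because the quiver has n vertices.  This gives a
    number of steps to the cycle that works for all vertices at once. *)
Lemma on_cycle_iter_n d : on_cycle phi (iter n phi d).
Proof.
have /trajectP[i ilt e] := looping_order phi d.
have ord_le : order phi d <= n by rewrite -[X in _ <= X]card_ord max_card.
have /(on_cycle_iter (n - order phi d)) : on_cycle phi (iter (order phi d) phi d).
  apply/on_cycleP; exists (order phi d - i).-1.
  by rewrite [in LHS]e prednK ?subn_gt0 // -iterD subnK // ltnW.
by rewrite -iterD subnK.
Qed.

Section Component.

Variable C : {set 'I_n}.
Hypothesis compC : C \in qcomponents phi.

Let cyc := central_cycle phi C.

Lemma qadj_connect_sym : connect_sym (qadj phi).
Proof. by apply: sym_connect_sym => i j; rewrite /qadj orbC. Qed.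

Lemma component_iter t j : (iter t phi j \in C) = (j \in C).
Proof.
have /imsetP[i _ ->] := compC; rewrite !inE.
apply: (@same_connect_r _ _ qadj_connect_sym).
elim: t j => [|t IH] j //=; rewrite -[iter t _ _]/(iter t phi j).
apply: connect_trans (IH j).
by apply: connect1; rewrite /qadj eqxx orbT.
Qed.

Lemma component_succ j : (phi j \in C) = (j \in C).
Proof. exact: (component_iter 1). Qed.

(** Following the oriented paths, any unoriented path can be contracted: two
    vertices joined by an arrow have the same later successors. *)
Lemma component_merge i j : i \in C -> j \in C ->
  exists s t, iter s phi i = iter t phi j.
Proof.
have /imsetP[r _ ->] := compC; rewrite !inE qadj_connect_sym => ri rj.
have /connectP[p] := connect_trans ri rj; elim: p i {ri} => [|x p IH] i /=.
  by move=> _ ->; exists 0, 0.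
move=> /andP[ix px] /(IH _ px)[s [t e]]; case/orP: ix => /eqP ix.
  by exists s.+1, t; rewrite iterSr ix.
case: s e => [/= e|s]; first by exists 0, t.+1; rewrite /= -e ix.
by rewrite iterSr ix => e; exists s, t.
Qed.

Lemma cycle_subset v : v \in cyc -> v \in C.
Proof. by rewrite inE => /andP[]. Qed.

Lemma cycle_succ v t : v \in cyc -> iter t phi v \in cyc.
Proof.
by rewrite !inE component_iter => /andP[-> cv]; apply: on_cycle_iter.
Qed.

Lemma component_reach d v : d \in C -> v \in cyc -> fconnect phi d v.
Proof.
move=> dC /[dup] /cycle_subset vC; rewrite inE => /andP[_ /on_cycleP[m e]].
have [s [t e']] := component_merge dC vC.
apply: (connect_trans (fconnect_iter phi s d)); rewrite e'.
(* From iter t phi v, the path goes on around the cycle to v, after a multiple of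
   the period m.+1. *)
have back r : iter (r * m.+1) phi v = v.
  by elim: r => // r IHr; rewrite mulSn iterD IHr.
rewrite -[X in connect _ _ X](back t) -(subnK (leq_pmulr t (ltn0Sn m))) iterD.
exact: fconnect_iter.
Qed.

Lemma component_cycle d : d \in C -> iter n phi d \in cyc.
Proof. by move=> dC; rewrite inE component_iter dC on_cycle_iter_n. Qed.

Lemma component_neq0 : exists d, d \in C.
Proof. by have /imsetP[i _ ->] := compC; exists i; rewrite inE. Qed.

Lemma cycle_card_gt0 : 0 < #|cyc|.
Proof.
by have [d /component_cycle dC] := component_neq0; apply/card_gt0P; exists (iter n phi d).
Qed.

Lemma cycle_card v : v \in cyc -> #|cyc| = order phi v.
Proof.
move=> vc; apply: eq_card => w; apply/idP/idP => [wc|/iter_findex <-].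
  exact: component_reach (cycle_subset vc) wc.
exact: cycle_succ.
Qed.

(** [findex] counts the arrows from phi v to v, which are all those of the cycle
    but one; this is the form in which the parity of the cycle is used. *)
Lemma cycle_findex v : v \in cyc -> #|cyc| = (findex phi (phi v) v).+1.
Proof.
move=> vc; have cv : fconnect phi (phi v) v.
  by apply: component_reach => //; rewrite component_succ cycle_subset.
rewrite (cycle_card vc); apply/eqP; rewrite eqn_leq; apply/andP; split.
  rewrite leqNgt; apply/negP => /(findex_iter (f := phi)).
  by rewrite iterSr iter_findex // findex0.
by rewrite -(cycle_card vc) (cycle_card (cycle_succ 1 vc)) /= findex_max.
Qed.

Lemma iter_cycle_card v : v \in cyc -> iter #|cyc| phi v = v.
Proof.
move=> vc; rewrite (cycle_findex vc) iterSr iter_findex //.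
by apply: component_reach => //; rewrite component_succ cycle_subset.
Qed.

Lemma loop_cycle v : v \in C -> phi v = v -> v \in cyc /\ #|cyc| = 1.
Proof.
move=> vC e; have vc : v \in cyc.
  by rewrite inE vC; apply/on_cycleP; exists 0.
by split=> //; rewrite (cycle_findex vc) e findex0.
Qed.

Lemma cycle_card1 v : v \in cyc -> #|cyc| = 1 -> phi v = v.
Proof. by move=> vc e; have := iter_cycle_card vc; rewrite e. Qed.

Lemma cycle_card2 v : v \in cyc -> #|cyc| = 2 -> phi (phi v) = v.
Proof. by move=> vc e; have := iter_cycle_card vc; rewrite e. Qed.

Lemma round_trip_cycle v : v \in C -> phi (phi v) = v -> v \in cyc /\ #|cyc| <= 2.
Proof.
move=> vC e; have vc : v \in cyc.
  by rewrite inE vC; apply/on_cycleP; exists 1.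
split=> //; rewrite (cycle_card vc) leqNgt; apply/negP => /(findex_iter (f := phi)).
by rewrite /= e findex0.
Qed.

Lemma component_tree_path d : d \in C -> exists e t, e \in cyc /\ tree_path phi d e t.
Proof.
move=> dC; have ex : exists t, on_cycle phi (iter t phi d) by exists n; apply: on_cycle_iter_n.
case: (ex_minnP ex) => t ct tmin; exists (iter t phi d), t; split.
  by rewrite inE component_iter dC.
by split=> // m mt; apply: contraL mt => /tmin; rewrite -leqNgt.
Qed.

Lemma loop_pred_path l d : phi l = l -> l \in C -> d \in C -> d <> l ->
  exists e t, [/\ phi e = l, e <> l & opath phi d e t].
Proof.
move=> pl lC dC; have [lc _] := loop_cycle lC pl.
have := iter_findex (component_reach dC lc).
move: (findex phi d l) => t; elim: t d {dC} => // t IH d; rewrite iterSr => e dl.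
have [pd|/eqP pd] := eqVneq (phi d) l; first by exists d, 0.
have [e' [s [pe el o]]] := IH _ e pd.
by exists e', s.+1; split=> //; rewrite /opath iterSr.
Qed.

End Component.

Lemma component_of j : exists2 C, C \in qcomponents phi & j \in C.
Proof.
exists [set i | connect (qadj phi) j i]%SET; last by rewrite inE.
exact: imset_f.
Qed.

End QuiverFacts.

(** * The coloring rules as local conditions *)

Section Coloration.

Variables (k : fieldType) (alpha beta : k) (n : nat) (phi : {ffun 'I_n -> 'I_n}).

Notation q := (q_poly alpha beta).
Notation alternate := (alternate alpha).
Implicit Types (a b : {ffun 'I_n -> k^o}) (C : {set 'I_n}).

Lemma alternateS r t : alternate r t.+1 = - alpha - alternate r t.
Proof. by rewrite /alternate /=; case: odd; rewrite //= opprB addrC subrK. Qed.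

Lemma alternate_succ r t : alternate (- alpha - r) t = - alpha - alternate r t.
Proof. by rewrite /alternate; case: odd => //; rewrite opprB addrC subrK. Qed.

Lemma root_q_alternate r t : root q (alternate r t) = root q r.
Proof.
rewrite /alternate; case: odd => //; rewrite !root_q; congr (_ == _); ring.
Qed.

Lemma root_q_swap r : root q (- alpha - r) = root q r.
Proof. exact: (root_q_alternate r 1). Qed.

(** The two roots of q have sum - alpha. *)
Lemma root_q_cases r r' : root q r -> root q r' -> r' = r \/ r' = - alpha - r.
Proof.
rewrite !root_q => /eqP r0 /eqP r'0.
have /eqP : (r' - r) * (r' - (- alpha - r)) = 0.
  by rewrite -[RHS](subrr 0) -{1}r'0 -r0; ring.
by rewrite mulf_eq0 !subr_eq0 => /orP[/eqP|/eqP]; [left|right].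
Qed.

Lemma root_pN r : root (p_poly alpha beta) r = root q (- r).
Proof.
rewrite root_q rootE /p_poly !hornerE; congr (_ == _); ring.
Qed.

Definition local_rule a (j : 'I_n) : Prop :=
  (phi j = j -> a j = 0) /\ edge_rule alpha beta phi a j.

(** What the local condition becomes on a component that has neither a loop nor
    only a round trip. *)
Definition alternates_at a (j : 'I_n) : Prop :=
  a (phi j) = - alpha - a j /\ root q (a j).

Section Component.

Variable C : {set 'I_n}.
Hypothesis compC : C \in qcomponents phi.

Let cyc := central_cycle phi C.

(** The involution r |-> - alpha - r is its own inverse, so colors can be read
    against the arrows, from successors to predecessors. *)
Lemma alternates_iter a d t : (forall j, j \in C -> a (phi j) = - alpha - a j) ->
  d \in C -> a d = alternate (a (iter t phi d)) t.
Proof.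
move=> alt dC; elim: t => // t IH.
by rewrite alternateS /= alt ?component_iter // alternate_succ opprB addrC subrK.
Qed.

Lemma alternates_eq a b : (forall j, j \in C -> a (phi j) = - alpha - a j) ->
  (forall j, j \in C -> b (phi j) = - alpha - b j) ->
  forall v, v \in cyc -> a v = b v -> forall d, d \in C -> a d = b d.
Proof.
move=> alta altb v vc e d dC; have /iter_findex rv := component_reach compC dC vc.
rewrite (alternates_iter (findex phi d v) alta dC) rv e -{1}rv.
exact/esym/alternates_iter.
Qed.

(** An immediate predecessor e of the loop vertex has phi (phi e) = phi e, so the
    color of e is not tied to the color 0 of the loop: alternation starts at e. *)
Lemma one_cycle_ruleP a : #|cyc| = 1%N ->
  one_cycle_rule alpha beta phi C a <-> forall j, j \in C -> local_rule a j.
Proof.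
move=> c1; split=> [H j jC|H l lc].
  have [l lc] : exists l, l \in cyc by apply/card_gt0P; rewrite c1.
  have lC := cycle_subset lc; have pl := cycle_card1 compC lc c1.
  have [al Hp] := H l lc.
  have [->|/eqP jl] := eqVneq j l; first by rewrite /local_rule /edge_rule pl.
  have [e [t [pe el o]]] := loop_pred_path compC pl lC jC jl.
  have [re tre] := Hp e pe el; have aj := tre _ _ o.
  split; last split => [ppj|_]; last by rewrite aj root_q_alternate.
    by move=> /(loop_cycle compC jC)[/(H _)[]].
  case: t o aj => [|t] o aj.
    by case: ppj; rewrite [j]o pe pl.
  have o' : opath phi (phi j) e t by rewrite /opath -iterSr.
  by rewrite aj (tre _ _ o') alternateS addrC subrK.
have lC := cycle_subset lc; have pl := cycle_card1 compC lc c1.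
have [al _] := H l lC; split=> [|e pe el]; first exact: al.
have eC : e \in C by rewrite -(component_succ compC) pe.
split; first by have [_ [_]] := H e eC; apply; rewrite pe pl => /esym.
move=> d t; elim: t d => [d <- //|t IH d]; rewrite /opath iterSr => o.
have dC : d \in C by rewrite -(component_succ compC) -(component_iter compC t) o.
have [_ [alt _]] := H d dC.
have <- : a (phi d) + a d - a (phi d) = a d by rewrite addrAC subrr add0r.
rewrite alt ?(IH _ o) ?alternateS // => ppd.
have fixed : iter t phi (phi d) = phi d by elim: t {IH o} => // t /= ->.
by apply: el; rewrite -pe -o fixed ppd.
Qed.

Lemma strict_two_cycleE : #|cyc| = 2%N -> strict phi C -> forall v, v \in C ->
  [/\ phi (phi v) = v, phi v <> v & forall w, w \in C -> w = v \/ w = phi v].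
Proof.
move=> c2 /eqP sC v vC; have cycC w : w \in C -> w \in cyc by rewrite /cyc -sC.
have ppv := cycle_card2 compC (cycC v vC) c2.
split=> // [/(loop_cycle compC vC)[_]|w wC]; first by rewrite -/cyc c2.
have /iter_findex <- := component_reach compC vC (cycC w wC).
by elim: findex => [|t []/= ->]; [left|right|left].
Qed.

Lemma strict_two_cycle_ruleP a : #|cyc| = 2%N -> strict phi C ->
  strict_two_cycle_rule alpha C a <-> forall j, j \in C -> local_rule a j.
Proof.
move=> c2 sC; split=> H.
  move=> j jC; have [ppj pj _] := strict_two_cycleE c2 sC jC.
  split=> //; rewrite /edge_rule ppj; split=> // _.
  by apply: H; rewrite ?component_succ.
move=> v w vC wC vw; have [ppv pv /(_ w wC)[/esym//|->]] := strict_two_cycleE c2 sC vC.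
by have [_ [alt _]] := H v vC; rewrite addrC alt // ppv => /esym.
Qed.

Definition alternating_type := (#|cyc| = 2%N /\ ~~ strict phi C) \/ (2 < #|cyc|)%N.

Lemma alternating_type_neq1 : alternating_type -> #|cyc| <> 1%N.
Proof. by case=> [[->]|] // + e; rewrite e. Qed.

(** Alternation along all arrows is the same as alternation around the cycle and
    along the trees, where every tree path ends on the cycle. *)
Lemma alternating_ruleP a : alternating_type ->
  alternating_rule alpha beta phi C a <-> forall j, j \in C -> alternates_at a j.
Proof.
move=> ty; split=> [[Hc Hu Ht] j jC|H].
  have [jc|jc] := boolP (j \in cyc); first by have [] := Hc j jc.
  have [e [[|t] [ec tp]]] := component_tree_path compC jC.
    by case: tp jc => [o _]; rewrite [j]o ec.
  have aj := Ht _ _ _ ec tp; have [re _] := Hc e ec.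
  split; last by rewrite aj root_q_alternate.
  case: tp => o notc; rewrite aj -alternateS [in RHS]/alternate /= negbK.
  apply: Ht (ec) _; split=> [|m mt]; first by rewrite /opath -iterSr.
  by rewrite -iterSr; apply: notc.
have alt j : j \in C -> a (phi j) = - alpha - a j by move=> /H[].
split=> [v /cycle_subset/H[]//|v u /cycle_subset vC e|e d t /cycle_subset eC [o _]].
  have uC : u \in C by rewrite -(component_succ compC) e.
  by rewrite -e alt // opprB addrC subrK.
by rewrite -o; apply: alternates_iter; rewrite // -(component_iter compC t) o.
Qed.

(** Without a loop, phi (phi j) = phi j never happens, so colors alternate on the
    whole component; being a root of q then spreads from one vertex to all. *)
Lemma alternating_localP a : alternating_type ->
  (forall j, j \in C -> alternates_at a j) <-> (forall j, j \in C -> local_rule a j).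
Proof.
move=> ty; have noloop j : j \in C -> phi j <> j.
  by move=> jC /(loop_cycle compC jC)[_]; apply: alternating_type_neq1.
split=> H j jC.
  have [alt rt] := H j jC; split; first by move/noloop; case.
  by split=> // _; rewrite alt subrK.
have alt i : i \in C -> a (phi i) = - alpha - a i.
  move=> iC; have [_ [<-]] := H i iC; rewrite ?addrK //.
  by apply: noloop; rewrite component_succ.
split; first exact: alt.
(* For s = 2 take a vertex outside the cycle, for s > 2 any vertex of the cycle. *)
have [u uC ppu] : exists2 u, u \in C & phi (phi u) <> u.
  case: ty => [[c2 sC]|c3].
    have /subsetPn[u uC uc] : ~~ (C \subset cyc).
      apply: contra sC => sub; rewrite /strict finset.eqEsubset sub.
      by apply/fintype.subsetP => v /cycle_subset.
    by exists u => // /(round_trip_cycle compC uC)[]; rewrite -/cyc (negPf uc).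
  have [v vc] : exists v, v \in cyc by apply/card_gt0P; apply: leq_trans c3.
  exists v; first exact: cycle_subset vc.
  by move=> /(round_trip_cycle compC (cycle_subset vc))[_]; rewrite leqNgt c3.
have ru : root q (a u) by have [_ [_]] := H u uC; apply.
have [s [t e]] := component_merge compC jC uC.
rewrite (alternates_iter s alt jC) e root_q_alternate.
by rewrite -(root_q_alternate _ t) -alternates_iter.
Qed.

Lemma component_ruleP a :
  component_rule alpha beta phi C a <-> forall j, j \in C -> local_rule a j.
Proof.
rewrite /component_rule -/cyc; case: eqP => [c1|/eqP c1]; first exact: one_cycle_ruleP.
case: andP => [[/eqP c2 sC]|ty]; first exact: strict_two_cycle_ruleP.
have {}ty : alternating_type.
  have := cycle_card_gt0 compC; rewrite -/cyc /alternating_type.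
  case: #|cyc| c1 ty => [|[|[|m]]] // _ ty _; last by right.
  by left; split=> //; apply/negP => sC; apply: ty.
by rewrite alternating_ruleP // alternating_localP.
Qed.

Lemma component_rule_alternating a : alternating_type ->
  component_rule alpha beta phi C a <-> forall j, j \in C -> alternates_at a j.
Proof. by move=> ty; rewrite component_ruleP alternating_localP. Qed.

End Component.

Lemma well_coloredP a : well_colored alpha beta phi a <-> forall j, local_rule a j.
Proof.
split=> [[_ H] j|H].
  have [C compC jC] := component_of phi j.
  by apply: (component_ruleP compC a).1 => //; apply: H.
split=> [j|C compC]; first by have [] := H j.
by apply/component_ruleP.
Qed.

Lemma well_colored_twisting a : well_colored alpha beta phi a <->
  is_coloration phi a /\ is_twisting (tau_map alpha beta phi a).
Proof.
rewrite well_coloredP is_twisting_tau_map; split=> [H|[H1 H2] j].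
  by split=> j; have [] := H j.
by split; [exact: H1 | exact: H2].
Qed.

End Coloration.

(** * Counting the colorings of one component *)

Lemma card_le_code (T : Type) (U : finType) (X : set T) (D : {set U}) (h : T -> U) :
  (forall x, X x -> h x \in D) -> (forall x y, X x -> X y -> h x = h y -> x = y) ->
  X #<= `I_#|D|.
Proof.
move=> hD hinj; pose g x := index (h x) (enum D).
have ginj : {in X &, injective g}.
  move=> x y /set_mem Xx /set_mem Xy /(congr1 (nth (h x) (enum D))).
  by rewrite !nth_index ?mem_enum ?hD //; apply: hinj.
rewrite -(card_le_eql (inj_card_eq ginj)); apply: subset_card_le => _ [x Xx <-] /=.
by rewrite cardE index_mem mem_enum hD.
Qed.

Section Counting.

Variables (k : fieldType) (alpha beta : k) (n : nat) (phi : {ffun 'I_n -> 'I_n}).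
Variable C : {set 'I_n}.
Hypothesis compC : C \in qcomponents phi.

Notation vec := {ffun 'I_n -> k^o}.
Notation q := (q_poly alpha beta).
Notation alternate := (alternate alpha).
Notation local_rule := (local_rule alpha beta phi).
Notation alternates_at := (alternates_at alpha beta phi).
Let cyc := central_cycle phi C.

Definition recolorings (a : vec) : set vec :=
  [set b : vec | (forall j, local_rule b j) /\ (forall i, i \notin C -> b i = a i)]%classic.

Lemma twistings_overE a :
  twistings_over alpha beta phi C a =
    [set tau_map alpha beta phi b | b in recolorings a]%classic.
Proof.
apply/seteqP; split=> [tau [tw [b [cb ba e]]]|_ [b [lb ba] <-]].
  exists b => //; split=> //; apply/well_coloredP/well_colored_twisting.
  by rewrite -e.
have /well_coloredP/well_colored_twisting[cb tb] := lb.
by split=> //; exists b.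
Qed.

(** A reference recoloring b0 is available to define the code h: when there is
    none, there is nothing to count.  Comparing colors with those of b0 encodes a
    choice of a root by a boolean without fixing an order on the roots. *)
Lemma twistings_over_le (U : finType) (D : {set U}) a :
  (forall b0, recolorings a b0 -> exists h : vec -> U,
     forall b b', recolorings a b -> recolorings a b' ->
      h b \in D /\ (h b = h b' -> forall j, j \in C -> b j = b' j)) ->
  twistings_over alpha beta phi C a #<= `I_#|D|.
Proof.
move=> H; rewrite twistings_overE; apply: card_le_trans (card_image_le _ _) _.
have [[b0 /H[h hP]]|none] := pselect (exists b, recolorings a b); last first.
  rewrite (_ : recolorings a = set0) ?card_ge0 //.
  by apply/seteqP; split=> // b rb; apply: none; exists b.
apply: (@card_le_code _ _ _ _ h) => [b rb|b b' rb rb' e]; first by have [] := hP b b rb rb.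
apply/ffunP => i; have [iC|iC] := boolP (i \in C).
  by have [_ ->] := hP b b' rb rb'.
by case: rb => _ -> //; case: rb' => _ ->.
Qed.

Lemma root_q_eq (r0 r r' : k) : root q r0 -> root q r -> root q r' ->
  (r == r0) = (r' == r0) -> r = r'.
Proof.
move=> r0q rq r'q; have [->|->] := root_q_cases r0q rq.
  by rewrite eqxx => /esym/eqP.
by have [->|->] := root_q_cases r0q r'q; rewrite ?eqxx // => /eqP.
Qed.

Section OneCycle.

Hypothesis cyc1 : #|cyc| = 1%N.

Let E := [set e | (phi e \in cyc) && (e \notin cyc)]%SET.

Lemma one_cycle_tree d : d \in C -> d \notin cyc ->
  exists e t, [/\ e \in E, e \in C, phi (phi e) <> e &
    forall a : vec, (forall j, local_rule a j) -> a d = alternate (a e) t].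
Proof.
have [l lc] : exists l, l \in cyc by apply/card_gt0P; rewrite cyc1.
have lC := cycle_subset lc; have pl := cycle_card1 compC lc cyc1.
move=> dC dc; have dl : d <> l by move=> dl; rewrite dl lc in dc.
have [e [t [pe el o]]] := loop_pred_path compC pl lC dC dl; exists e, t.
have ec : e \notin cyc.
  by apply/negP => ec; apply: el; rewrite -(cycle_card1 compC ec cyc1).
split.
- by rewrite inE pe lc.
- by rewrite -(component_succ compC) pe.
- by rewrite pe pl => /esym.
move=> a la; have /one_cycle_ruleP H : forall j, j \in C -> local_rule a j by [].
by have [_ /(_ e pe el)[_ tr]] := H compC cyc1 l lc; apply: tr.
Qed.

(** A recoloring is coded by the set of immediate predecessors of the loop where
    it agrees with a reference recoloring. *)
Lemma one_cycle_twistings a : twistings_over alpha beta phi C a #<= `I_(2 ^ #|E|).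
Proof.
rewrite -card_powerset; apply: twistings_over_le => b0 [lb0 _].
exists (fun b => [set e in E | b e == b0 e]%SET) => b b' [lb _] [lb' _]; split.
  by rewrite inE; apply/fintype.subsetP => e; rewrite inE => /andP[].
move=> h j jC; have [jc|jc] := boolP (j \in cyc).
  have pj := cycle_card1 compC jc cyc1.
  by have [-> //] := lb j; have [-> //] := lb' j.
have [e [t [eE eC ppe tree]]] := one_cycle_tree jC jc; rewrite !tree //.
congr alternate; have /finset.setP/(_ e) := h; rewrite !inE in eE *; rewrite eE /=.
have rt (c : vec) : (forall j, local_rule c j) -> root q (c e).
  by move=> /(_ e)[_ [_]]; apply.
by apply: root_q_eq; apply: rt.
Qed.

Lemma one_cycle_strict a : (forall r : k, ~~ root q r) ->
  well_colored alpha beta phi a -> strict phi C.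
Proof.
move=> noroot /well_coloredP la; rewrite /strict finset.eqEsubset.
apply/andP; split; last first.
  by apply/fintype.subsetP => v /cycle_subset.
apply/fintype.subsetP => d dC; apply/negPn/negP => /(one_cycle_tree dC)[e [t [_ _ ppe _]]].
by have [_ [_ /(_ ppe)]] := la e; apply/negP.
Qed.

End OneCycle.

Lemma local_rule_ext (a b : vec) j : a j = b j -> a (phi j) = b (phi j) ->
  local_rule a j -> local_rule b j.
Proof. by rewrite /local_rule /edge_rule => -> ->. Qed.

Lemma strict_two_cycle_twistings a v : #|cyc| = 2%N -> strict phi C ->
  well_colored alpha beta phi a -> v \in C ->
  set_bij [set: k]%classic (twistings_over alpha beta phi C a)
    (fun c => tau_map alpha beta phi
       [ffun i => if i == v then c else if i == phi v then - alpha - c else a i]).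
Proof.
move=> c2 sC /well_coloredP la vC; have [ppv pv Cv] := strict_two_cycleE compC c2 sC vC.
have pvv : phi v == v = false by apply/eqP.
set g := fun c : k =>
  [ffun i => if i == v then c else if i == phi v then - alpha - c else a i] : vec.
have gv c : g c v = c by rewrite ffunE eqxx.
have gpv c : g c (phi v) = - alpha - c by rewrite ffunE pvv eqxx.
have gN c i : i \notin C -> g c i = a i.
  move=> iC; rewrite ffunE; case: eqP => [e|_]; first by rewrite e vC in iC.
  by case: eqP => // e; rewrite e component_succ // vC in iC.
have lg c j : local_rule (g c) j.
  have [jC|jC] := boolP (j \in C); last first.
    by apply: local_rule_ext (la j); rewrite gN // component_succ.
  apply: (strict_two_cycle_ruleP alpha beta compC (g c) c2 sC).1 _ j jC => u w uC wC uw.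
  have [eu|eu] := Cv u uC; have [ew|ew] := Cv w wC; subst u w => //.
    by rewrite gv gpv addrC subrK.
  by rewrite gv gpv subrK.
rewrite twistings_overE; split.
- by move=> c _; exists (g c) => //; split=> //; apply: gN.
- move=> c c' _ _ /tau_map_inj[||_ /ffunP/(_ v)]; last by rewrite !gv.
    by move=> j; have [] := lg c j.
  by move=> j; have [] := lg c' j.
move=> _ [b [lb ba] <-]; exists (b v) => //; congr tau_map; apply/ffunP => i; rewrite ffunE.
case: eqP => [-> //|iv]; case: eqP => [->|ipv].
  by have [_ [<-]] := lb v; rewrite ?addrK // ppv => /esym.
by rewrite ba //; apply/negP => /Cv[].
Qed.

Section Alternating.

Hypothesis ty : alternating_type phi C.

Lemma component_coloringsP (a : vec) : component_colorations alpha beta phi C a <->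
  (forall i, i \notin C -> a i = 0) /\ (forall j, j \in C -> alternates_at a j).
Proof.
split=> -[z H]; split=> //.
  exact/(component_rule_alternating alpha beta compC a ty).
exact/(component_rule_alternating alpha beta compC a ty).
Qed.

Lemma component_colorings_eq (a b : vec) v : component_colorations alpha beta phi C a ->
  component_colorations alpha beta phi C b -> v \in cyc -> a v = b v -> a = b.
Proof.
move=> /component_coloringsP[za la] /component_coloringsP[zb lb] vc e.
apply/ffunP => i; have [iC|iC] := boolP (i \in C); last by rewrite za // zb.
exact: (alternates_eq compC (fun j jC => (la j jC).1) (fun j jC => (lb j jC).1) vc e iC).
Qed.

(** Reading the cycle n arrows further gives the same answer on the cycle and
    is defined on all the trees. *)
Lemma cycle_coloring_extends (c : vec) : cycle_rule alpha beta phi C c ->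
  exists! a, component_colorations alpha beta phi C a /\ forall v, v \in cyc -> a v = c v.
Proof.
move=> cr; have cN v t : v \in cyc -> c v = alternate (c (iter t phi v)) t.
  move=> vc; elim: t => // t IH.
  have [_ e] := cr _ (cycle_succ compC t vc).
  by rewrite alternateS /= e alternate_succ opprB addrC subrK.
set a : vec := [ffun d => if d \in C then alternate (c (iter n phi d)) n else 0].
have ac v : v \in cyc -> a v = c v by move=> vc; rewrite ffunE (cycle_subset vc) -cN.
have col : component_colorations alpha beta phi C a.
  apply/component_coloringsP; split=> [i /negPf iC|d dC]; first by rewrite ffunE iC.
  have [re e] := cr _ (component_cycle compC dC).
  rewrite /alternates_at !ffunE component_succ // dC root_q_alternate -iterSr /= e.
  by rewrite alternate_succ.
exists a; split=> // b [cb bc].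
have [v vc] : exists v, v \in cyc by apply/card_gt0P; apply: cycle_card_gt0.
by apply: (component_colorings_eq col cb vc); rewrite ac // bc.
Qed.

(** A root is placed at a vertex v of the cycle and propagated by the parity of
    the distance to v, which changes along every arrow: it does so also along the
    arrow leaving v, because the cycle is even. *)
Lemma even_cycle_colorings : ~~ odd #|cyc| ->
  component_colorations alpha beta phi C #= [set r : k | root (p_poly alpha beta) r]%classic.
Proof.
move=> ev; have [v vc] : exists v, v \in cyc by apply/card_gt0P; apply: cycle_card_gt0.
have vC := cycle_subset vc.
apply: (pcard_eq (bij_of_set_bijection (f := fun a : vec => - a v) _)); split.
- by move=> a /component_coloringsP[_ /(_ v vC)[_ rv]]; rewrite /= root_pN opprK.
- move=> a b /set_mem ca /set_mem cb /oppr_inj; exact: component_colorings_eq ca cb vc.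
move=> r /=; rewrite root_pN => rq.
exists [ffun d => if d \in C then alternate (- r) (findex phi d v) else 0]; last first.
  by rewrite ffunE vC findex0 /= opprK.
apply/component_coloringsP; split=> [i /negPf iC|d dC]; first by rewrite ffunE iC.
rewrite /alternates_at !ffunE component_succ // dC root_q_alternate; split=> //.
have [<-|dv] := eqVneq v d; last first.
  by rewrite (fconnect_findex (component_reach compC dC vc) dv) alternateS opprB addrC subrK.
move: ev; rewrite /cyc (cycle_findex compC vc) /= negbK => od.
by rewrite findex0 /Defs.alternate od.
Qed.

(** Going once around the cycle applies the involution an odd number of times. *)
Lemma odd_cycle_fixed (a : vec) j : odd #|cyc| ->
  component_colorations alpha beta phi C a -> j \in C -> a j = - alpha - a j.
Proof.
move=> od /component_coloringsP[_ la] jC.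
have alt i : i \in C -> a (phi i) = - alpha - a i by move=> /la[].
have vc := component_cycle compC jC.
have e : a (iter n phi j) = - alpha - a (iter n phi j).
  rewrite {1}(alternates_iter compC #|cyc| alt (cycle_subset vc)) iter_cycle_card //.
  by rewrite /Defs.alternate od.
by rewrite (alternates_iter compC n alt jC) -alternate_succ -e.
Qed.

(** A color fixed by the involution is a root r of q with - alpha - r = r, that is,
    the only root of q; then the constant coloring is the only coloring. *)
Lemma odd_cycle_colorings : odd #|cyc| ->
  ((exists a, component_colorations alpha beta phi C a) <->
     (exists! r : k, root (p_poly alpha beta) r)) /\
  (forall a b, component_colorations alpha beta phi C a ->
     component_colorations alpha beta phi C b -> a = b).
Proof.
move=> od; have [v vc] : exists v, v \in cyc by apply/card_gt0P; apply: cycle_card_gt0.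
have vC := cycle_subset vc.
have only (a : vec) r : component_colorations alpha beta phi C a -> root q r -> r = a v.
  move=> /[dup] /component_coloringsP[_ /(_ v vC)[_ rv]] ca rr.
  by have [//|->] := root_q_cases rv rr; rewrite -(odd_cycle_fixed od ca vC).
split; last first.
  move=> a b ca cb; apply: (component_colorings_eq ca cb vc); apply/esym/only => //.
  by have /component_coloringsP[_ /(_ v vC)[]] := cb.
split=> [[a ca]|[r [rr ru]]].
  exists (- a v); split=> [|r]; rewrite root_pN ?opprK.
    by have /component_coloringsP[_ /(_ v vC)[]] := ca.
  by move=> /(only a _ ca) <-; rewrite opprK.
have er : - alpha - - r = - r.
  have -> : - alpha - - r = - (alpha - r) by rewrite opprK opprB addrC.
  congr (- _); apply/esym/ru; rewrite root_pN -root_q_swap opprK addrA addNr.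
  by rewrite sub0r -root_pN.
exists [ffun d => if d \in C then - r else 0]; apply/component_coloringsP.
split=> [i /negPf iC|d dC]; first by rewrite ffunE iC.
by rewrite /alternates_at !ffunE component_succ // dC er -root_pN.
Qed.

Lemma alternating_twistings a : twistings_over alpha beta phi C a #<= `I_2.
Proof.
have [v vc] : exists v, v \in cyc by apply/card_gt0P; apply: cycle_card_gt0.
rewrite -card_bool -cardsT; apply: twistings_over_le => b0 [lb0 _].
exists (fun b => b v == b0 v) => b b' [lb _] [lb' _]; split; first by rewrite inE.
have alt (c : vec) : (forall j, local_rule c j) -> forall j, j \in C -> alternates_at c j.
  by move=> lc; apply/(alternating_localP alpha beta compC c ty).
have [alb alb' alb0] := And3 (alt b lb) (alt b' lb') (alt b0 lb0).
have vC := cycle_subset vc; move=> h.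
have e : b v = b' v.
  by apply: root_q_eq h; [case: (alb0 v vC) | case: (alb v vC) | case: (alb' v vC)].
exact: (alternates_eq compC (fun j jC => (alb j jC).1) (fun j jC => (alb' j jC).1) vc e).
Qed.

End Alternating.

End Counting.

(** * The correspondence *)

Theorem theorem2p4 (k : fieldType) (n : nat) (alpha beta : k) :
  (2 <= n)%N ->
  set_bij
    [set x : {ffun 'I_n -> 'I_n} * {ffun 'I_n -> k^o}
      | well_colored alpha beta x.1 x.2]%classic
    [set tau | is_twisting tau]%classic
    (fun x => tau_map alpha beta x.1 x.2)
  /\
  forall (phi : {ffun 'I_n -> 'I_n}) (C : {set 'I_n}), C \in qcomponents phi ->
  let cyc := central_cycle phi C in
  let s := #|cyc| in
  let p := p_poly alpha beta in
  let q := q_poly alpha beta in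
  [/\
    (s = 1%N ->
      (forall a : {ffun 'I_n -> k^o},
         twistings_over alpha beta phi C a
           #<= `I_(2 ^ #|[set e | (phi e \in cyc) && (e \notin cyc)]%SET|))
      /\
      ((forall r : k, ~~ root q r) ->
         forall a : {ffun 'I_n -> k^o},
         well_colored alpha beta phi a -> strict phi C)),
    (s = 2%N -> strict phi C ->
      forall (a : {ffun 'I_n -> k^o}) (v : 'I_n),
      well_colored alpha beta phi a -> v \in C ->
      set_bij [set: k]%classic (twistings_over alpha beta phi C a)
        (fun c => tau_map alpha beta phi
           [ffun i => if i == v then c
                      else if i == phi v then - alpha - c else a i])) &
    ((s = 2%N /\ ~~ strict phi C \/ (2 < s)%N) ->
      [/\ (forall c : {ffun 'I_n -> k^o}, cycle_rule alpha beta phi C c ->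
             exists! a, component_colorations alpha beta phi C a /\
                        forall v, v \in cyc -> a v = c v),
          (~~ odd s ->
             component_colorations alpha beta phi C #= [set r : k | root p r]%classic),
          (odd s ->
             ((exists a, component_colorations alpha beta phi C a) <->
              (exists! r : k, root p r)) /\
             (forall a b, component_colorations alpha beta phi C a ->
                component_colorations alpha beta phi C b -> a = b)) &
          (forall a : {ffun 'I_n -> k^o},
             twistings_over alpha beta phi C a #<= `I_2)])].
Proof.
move=> _; split.
  split.
  - by move=> [phi a] /well_colored_twisting[].
  - move=> [phi a] [phi' a'] /set_mem/well_colored_twisting[/= ca _].
    move=> /set_mem/well_colored_twisting[/= ca' _] e.
    by have [-> ->] := tau_map_inj ca ca' e.
  - move=> tau tt; have [phi [a [ca e]]] := is_twistingE tt.
    by exists (phi, a) => //; apply/well_colored_twisting; rewrite -e.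
move=> phi C compC cyc s p q; split.
- move=> c1; split=> [a|noroot a wa]; first exact: one_cycle_twistings.
  exact: one_cycle_strict wa.
- by move=> c2 sC a v wa vC; apply: strict_two_cycle_twistings.
move=> ty; split.
- by move=> c; apply: cycle_coloring_extends.
- exact: even_cycle_colorings.
- exact: odd_cycle_colorings.
- exact: alternating_twistings.
Qed.
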